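(* Let $T\colon C[0,1]\to C[0,1]$ be the Cesàro operator. Then $\|T^nf-Pf\|_\infty\to0$ as $n\to\infty$ for all $f\in C[0,1]$. Furthermore, if $f\in C[0,1]$ is such that the improper Riemann integral $\int_0^1\frac{f(t)-f(0)}{t}\,\mathrm{d}t$ exists, then $\|T^nf-Pf\|_\infty=O(n^{-1/2})$ as $n\to\infty$.
   Context: $C[0,1]$ denotes the complex Banach space of continuous functions $f\colon[0,1]\to\mathbb{C}$ with the supremum norm $\|\cdot\|_\infty$. The Cesàro operator $T$ on $C[0,1]$ is the bounded linear operator defined by $(Tf)(0)=f(0)$ and $(Tf)(t)=\frac1t\int_0^tf(s)\,\mathrm{d}s$ for $0<t\le1$. The operator $P\colon C[0,1]\to C[0,1]$ is defined by $(Pf)(t)=f(0)$ for $0\le t\le1$. The improper Riemann integral is said to exist if $\lim_{\varepsilon\to0+}\int_\varepsilon^1\frac{f(t)-f(0)}{t}\,\mathrm{d}t$ exists in $\mathbb{C}$. *)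

(* Defs.v *)
From Stdlib Require Import Reals Lra.
From Coquelicot Require Import Coquelicot.

Open Scope R_scope.

(* The elements of C[0,1].  Coquelicot has no type of functions on [0,1], so an
   element is carried by a function R -> C that is continuous on [0,1] for the
   topology relative to [0,1] (one-sided at the end points).  Values outside
   [0,1] are irrelevant: the operators and the norm below only see [0,1]. *)
Definition unit_interval (t : R) : Prop := 0 <= t <= 1.

Record C01 : Type := mkC01 {
  C01_fun :> R -> C;
  C01_cont : continuous_on (U := C_UniformSpace) unit_interval C01_fun }.

(* [Lub_Rbar] is Rbar-valued; [supnorm_is_lub] below shows that the supremum is
   finite, so the projection to R loses nothing. *)
Definition supnorm (f : C01) : R :=
  real (Lub_Rbar (fun r => exists t, unit_interval t /\ r = Cmod (f t))).

(* The integral is the Riemann integral with values in C seen as a real Banach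
   space. *)
Definition cesaro_fun (f : R -> C) (t : R) : C :=
  if Req_EM_T t 0 then f 0
  else (/ RtoC t * RInt (V := C_R_CompleteNormedModule) f 0 t)%C.

Definition clamp (t : R) : R := Rmax 0 (Rmin 1 t).

Lemma clamp_unit t : unit_interval (clamp t).
Proof.
unfold clamp, unit_interval, Rmax, Rmin.
destruct (Rle_dec 1 t); destruct (Rle_dec 0 _); lra.
Qed.

Lemma clamp_id t : unit_interval t -> clamp t = t.
Proof.
unfold clamp, unit_interval, Rmax, Rmin; intros H.
destruct (Rle_dec 1 t); destruct (Rle_dec 0 _); lra.
Qed.

Lemma clamp_dist s t : Rabs (clamp s - clamp t) <= Rabs (s - t).
Proof.
unfold clamp, Rmin.
destruct (Rle_dec 1 s); destruct (Rle_dec 1 t); unfold Rmax;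
repeat destruct (Rle_dec 0 _); unfold Rabs; repeat destruct Rcase_abs; lra.
Qed.

Lemma C01_clamp_continuous (f : C01) (t : R) :
  continuous (U := C_UniformSpace) (fun s => f (clamp s)) t.
Proof.
unfold continuous.
apply (filterlim_comp _ _ _ clamp f _ (within unit_interval (locally (clamp t)))).
- intros P [d Hd].
  exists d; intros s Hs.
  apply Hd; [| apply clamp_unit].
  exact (Rle_lt_trans _ _ _ (clamp_dist s t) Hs).
- apply C01_cont, clamp_unit.
Qed.

Lemma C01_clamp_ex_RInt (f : C01) (a b : R) :
  ex_RInt (V := C_R_NormedModule) (fun s => f (clamp s)) a b.
Proof.
apply (ex_RInt_continuous (V := C_R_CompleteNormedModule)).
intros z _; exact (C01_clamp_continuous f z).
Qed.

Lemma C01_RInt_clamp (f : C01) (t : R) : unit_interval t ->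
  RInt (V := C_R_CompleteNormedModule) f 0 t
  = RInt (V := C_R_CompleteNormedModule) (fun s => f (clamp s)) 0 t.
Proof.
intros Ht; apply (RInt_ext (V := C_R_CompleteNormedModule)).
intros x; unfold unit_interval in Ht.
rewrite Rmin_left, Rmax_right by lra; intros Hx.
rewrite clamp_id; [reflexivity | unfold unit_interval; lra].
Qed.

Lemma C_Cmod_continuous (z : C) : continuous (T := C_UniformSpace) Cmod z.
Proof. exact (filterlim_norm (V := C_NormedModule) z). Qed.

Lemma C_R_norm (z : C) : norm (V := C_R_NormedModule) z = Cmod z.
Proof.
change (sqrt (Rabs (fst z) ^ 2 + Rabs (snd z) ^ 2) = Cmod z).
unfold Cmod; rewrite !pow2_abs; reflexivity.
Qed.

Lemma supnorm_is_lub (f : C01) :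
  is_lub (fun r => exists t, unit_interval t /\ r = Cmod (f t)) (supnorm f).
Proof.
destruct (continuity_ab_maj (fun t => Cmod (f (clamp t))) 0 1) as [m [Hm Hm01]].
- lra.
- intros c _.
  apply continuity_pt_filterlim.
  apply (filterlim_comp _ _ _ (fun s => f (clamp s)) Cmod _
           (locally (T := C_UniformSpace) (f (clamp c)))).
  + apply C01_clamp_continuous.
  + apply C_Cmod_continuous.
- assert (L : is_lub_Rbar (fun r => exists t, unit_interval t /\ r = Cmod (f t))
                (Cmod (f m))).
  { split.
    - intros r [t [Ht ->]]; simpl.
      specialize (Hm t Ht); rewrite !clamp_id in Hm; auto.
    - intros b Hb; apply Hb; exists m; split; auto. }
  unfold supnorm; rewrite (is_lub_Rbar_unique _ _ L); simpl.
  destruct L as [L1 L2]; split.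
  + intros r Hr; exact (L1 r Hr).
  + intros b Hb; exact (L2 (Finite b) (fun r Hr => Hb r Hr)).
Qed.

Lemma cesaro_cont (f : C01) :
  continuous_on (U := C_UniformSpace) unit_interval (cesaro_fun f).
Proof.
intros t Ht.
destruct (Req_EM_T t 0) as [-> | Hne].
- apply (filterlim_locally (U := C_UniformSpace)); intros eps.
  assert (He : 0 < eps / 2) by (destruct eps; simpl; lra).
  assert (H0 := C01_clamp_continuous f 0).
  destruct (proj1 (filterlim_locally_ball_norm (U := C_R_NormedModule)
              (F := locally 0) _ _) H0 (mkposreal _ He)) as [d Hd].
  rewrite (clamp_id 0 Ht) in Hd.
  exists d; intros s Hs Hs1.
  apply (norm_compat1 (V := C_R_NormedModule)).
  unfold cesaro_fun; destruct (Req_EM_T 0 0) as [_ |]; [| lra].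
  destruct (Req_EM_T s 0) as [_ | Hs0].
  + rewrite C_R_norm; change (Cmod (f 0 - f 0) < eps).
    unfold Cminus; rewrite Cplus_opp_r, Cmod_0; apply eps.
  + unfold unit_interval in Hs1.
    rewrite C01_RInt_clamp by exact Hs1.
    set (I := RInt _ 0 s).
    assert (HI : is_RInt (V := C_R_NormedModule)
              (fun u => minus (G := C_R_NormedModule) (f (clamp u)) (f 0)) 0 s
              (minus (G := C_R_NormedModule) I (scal (s - 0) (f 0 : C_R_NormedModule)))).
    { apply (is_RInt_minus (V := C_R_NormedModule)).
      - apply (RInt_correct (V := C_R_CompleteNormedModule)), C01_clamp_ex_RInt.
      - apply (is_RInt_const (V := C_R_NormedModule)). }
    assert (HB : norm (K := R_AbsRing) (V := C_R_NormedModule)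
              (minus (G := C_R_NormedModule) I (scal (s - 0) (f 0 : C_R_NormedModule)))
            <= (s - 0) * (eps / 2)).
    { apply (norm_RInt_le_const (V := C_R_NormedModule)
        (fun u => minus (G := C_R_NormedModule) (f (clamp u)) (f 0))); auto.
      - lra.
      - intros u Hu; apply Rlt_le.
        apply (Hd u).
        change (Rabs (u - 0) < d); change (Rabs (s - 0) < d) in Hs.
        rewrite Rabs_pos_eq in * by lra; lra. }
    assert (Hs' : RtoC s <> 0) by (intros E; apply Hs0, RtoC_inj, E).
    rewrite C_R_norm.
    change (Cmod (/ RtoC s * I - f 0) < eps).
    rewrite C_R_norm in HB.
    change (Cmod (I - scal (V := C_R_ModuleSpace) (s - 0) (f 0 : C))
            <= (s - 0) * (eps / 2)) in HB.
    rewrite scal_R_Cmult, Rminus_0_r in HB.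
    replace (/ RtoC s * I - f 0)%C with (/ RtoC s * (I - RtoC s * f 0))%C
      by (field; auto).
    rewrite Cmod_mult, Cmod_inv, Cmod_R, Rabs_pos_eq by (auto; lra).
    apply Rle_lt_trans with (/ s * (s * (eps / 2))).
    * apply Rmult_le_compat_l; auto.
      apply Rlt_le, Rinv_0_lt_compat; lra.
    * replace (/ s * (s * (eps / 2))) with (eps / 2) by (field; lra).
      destruct eps; simpl in *; lra.
- assert (Hpos : 0 < t) by (unfold unit_interval in Ht; lra).
  set (g := fun s => scal (V := C_R_NormedModule) (/ s)
         (RInt (V := C_R_CompleteNormedModule) (fun u => f (clamp u)) 0 s)).
  assert (E : forall s, unit_interval s -> s <> 0 -> cesaro_fun f s = g s).
  { intros s Hs Hs0; unfold cesaro_fun, g.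
    destruct (Req_EM_T s 0) as [| _]; [contradiction |].
    rewrite C01_RInt_clamp by exact Hs.
    rewrite <- RtoC_inv by exact Hs0.
    symmetry; apply scal_R_Cmult. }
  rewrite E by auto.
  assert (Hg : continuous (U := C_UniformSpace) g t).
  { apply (continuous_scal (V := C_R_NormedModule) (fun s => / s)).
    - apply continuous_Rinv; exact Hne.
    - apply (continuous_RInt_1 (V := C_R_NormedModule) (fun u => f (clamp u)) 0 t).
      apply filter_forall; intros s.
      apply (RInt_correct (V := C_R_CompleteNormedModule)), C01_clamp_ex_RInt. }
  apply (filterlim_ext_loc g).
  + exists (mkposreal t Hpos); intros s Hs Hs1.
    symmetry; apply E; auto.
    intros ->; change (Rabs (0 - t) < t) in Hs.
    rewrite Rabs_left in Hs by lra; lra.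
  + intros P HP; apply filter_le_within, (Hg P HP).
Qed.

Definition cesaro (f : C01) : C01 := mkC01 (cesaro_fun f) (cesaro_cont f).

Lemma const_cont (c : C) :
  continuous_on (U := C_UniformSpace) unit_interval (fun _ => c).
Proof.
apply continuous_on_forall; intros t _.
apply (continuous_const (V := C_UniformSpace)).
Qed.

Definition eval0 (f : C01) : C01 := mkC01 (fun _ => f 0) (const_cont (f 0)).

Lemma minus_cont (f g : C01) :
  continuous_on (U := C_UniformSpace) unit_interval (fun t => f t - g t)%C.
Proof.
intros t Ht.
apply (filterlim_comp_2 (G := locally (T := C_UniformSpace) (f t))
         (H := locally (T := C_UniformSpace) (- g t)%C)
         (f : R -> C) (fun s => - g s)%C Cplus).
- apply C01_cont, Ht.
- apply (filterlim_comp _ _ _ (g : R -> C) Copp _ (locally (T := C_UniformSpace) (g t))).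
  + apply C01_cont, Ht.
  + apply (filterlim_opp (V := C_R_NormedModule) (g t)).
- apply (filterlim_plus (V := C_R_NormedModule) (f t) (- g t)%C).
Qed.

Definition C01_minus (f g : C01) : C01 :=
  mkC01 (fun t => f t - g t)%C (minus_cont f g).

Definition improper_integral_exists (f : C01) : Prop :=
  exists l : C,
    filterlim
      (fun eps => RInt (V := C_R_CompleteNormedModule)
                    (fun t => (f t - f 0) / RtoC t)%C eps 1)
      (at_right 0) (locally (T := C_UniformSpace) l).

Definition bigO (u v : nat -> R) : Prop :=
  exists M : R, eventually (fun n => Rabs (u n) <= M * Rabs (v n)).

(* Main.v *)
(** Since [T] fixes constants, take [f 0 = 0] and treat real and imaginary parts
    separately.  The bound [|f t| <= e + K t] becomes [|T^n f t| <= e + K t / 2^n],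
    which gives the convergence.

    For the rate, let [H t] be the integral of [f s / s] from [d] to [t] for
    [t >= d], and [0] for [t <= d].  Then [T f - (H - T H)] is at most
    [sup_[0,d] |f|] in norm, and [H] is bounded uniformly in [d] when the improper
    integral exists, so it is enough to show
    [||T^n g - T^(n+1) g|| <= ||g|| / sqrt n] for [g] vanishing on [[0,d]].  Let [L]
    be multiplication by [- ln]; the vanishing keeps [L g] continuous.  Integration
    by parts gives [T L - L T = T^2], hence [T^n L - L T^n = n T^(n+1)], so that
    [T^n g - T^(n+1) g] at [t] is [T^n ((1 - (L - L t) / n) g)] at [t].  By AM-GM the
    weight is at most [(L - L t - n)^2 / (2 n sqrt n) + 1 / (2 sqrt n)] in modulus, and
    [T] maps [a (L - m)^2 + b] to [a (L - m + 1)^2 + a + b]; after [n] steps the square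
    vanishes at [t] and [1 / sqrt n] remains.  (Probabilistically: the variance of the
    Gamma law of [L] under the kernel of [T^n] is [n].) *)

Require Import Defs.
From Stdlib Require Import Reals Lra Lia.
From Coquelicot Require Import Coquelicot.
Open Scope R_scope.

(** * The averaging operator on continuous real functions on the line *)

Definition rcesaro (f : R -> R) (t : R) : R :=
  if Req_EM_T t 0 then f 0 else / t * RInt f 0 t.

Lemma continuous_ex_RInt (f : R -> R) (a b : R) :
  (forall x, continuous f x) -> ex_RInt f a b.
Proof.
intros Hf; apply (ex_RInt_continuous (V := R_CompleteNormedModule)); auto.
Qed.

Lemma is_derive_RInt_continuous (f : R -> R) (a x : R) :
  (forall y, continuous f y) -> is_derive (RInt f a) x (f x).
Proof.
intros Hf.
apply (is_derive_RInt (V := R_CompleteNormedModule) f (RInt f a) a x).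
- apply filter_forall; intros y.
  apply (RInt_correct (V := R_CompleteNormedModule)), continuous_ex_RInt, Hf.
- apply Hf.
Qed.

Lemma rcesaro_0 (f : R -> R) : rcesaro f 0 = f 0.
Proof. unfold rcesaro; destruct (Req_EM_T 0 0); lra. Qed.

Lemma rcesaro_neq0 (f : R -> R) (t : R) :
  t <> 0 -> rcesaro f t = / t * RInt f 0 t.
Proof. unfold rcesaro; destruct (Req_EM_T t 0); lra. Qed.

(** The mean value theorem for the primitive of [f]. Continuity at 0, invariance of constants and
    preservation of vanishing near 0 all follow from it. Negative [t] is included because continuity
    at 0 is two-sided here. *)
Lemma rcesaro_mean (f : R -> R) (t : R) : (forall x, continuous f x) ->
  exists c, Rmin 0 t <= c <= Rmax 0 t /\ rcesaro f t = f c.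
Proof.
intros Hf.
destruct (Req_dec t 0) as [-> | Ht].
- exists 0; rewrite rcesaro_0, Rmin_left, Rmax_left by lra; lra.
- destruct (MVT_gen (RInt f 0) 0 t f) as [c [Hc Ec]].
  + intros x _; apply is_derive_RInt_continuous, Hf.
  + intros x _; apply continuity_pt_filterlim.
    apply (ex_derive_continuous (RInt f 0)).
    exists (f x); apply is_derive_RInt_continuous, Hf.
  + exists c; split; auto.
    rewrite RInt_point in Ec; change (zero : R) with 0 in Ec.
    rewrite rcesaro_neq0 by auto.
    replace (RInt f 0 t) with (f c * (t - 0)) by lra; field; auto.
Qed.

Lemma rcesaro_continuous (f : R -> R) :
  (forall x, continuous f x) -> forall x, continuous (rcesaro f) x.
Proof.
intros Hf x.
destruct (Req_dec x 0) as [-> | Hx].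
- apply (filterlim_locally (U := R_UniformSpace)); intros eps.
  destruct (proj1 (filterlim_locally (U := R_UniformSpace) (F := locally 0) _ _)
              (Hf 0) eps) as [d Hd].
  exists d; intros t Ht.
  destruct (rcesaro_mean f t Hf) as [c [Hc Ec]].
  rewrite rcesaro_0, Ec; apply Hd.
  change (Rabs (c - 0) < d); change (Rabs (t - 0) < d) in Ht.
  revert Hc Ht; unfold Rmin, Rmax, Rabs.
  destruct (Rle_dec 0 t); destruct (Rcase_abs (c - 0));
    destruct (Rcase_abs (t - 0)); lra.
- apply (continuous_ext_loc _ (fun s => / s * RInt f 0 s)).
  + exists (mkposreal _ (Rabs_pos_lt _ Hx)); intros s Hs.
    symmetry; apply rcesaro_neq0; intros ->.
    change (Rabs (0 - x) < Rabs x) in Hs.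
    rewrite Rminus_0_l, Rabs_Ropp in Hs; lra.
  + apply (continuous_mult (fun s => / s) (RInt f 0)).
    * apply continuous_Rinv; exact Hx.
    * apply (ex_derive_continuous (RInt f 0)).
      exists (f x); apply is_derive_RInt_continuous, Hf.
Qed.

Lemma iter_rcesaro_continuous (n : nat) (f : R -> R) :
  (forall x, continuous f x) -> forall x, continuous (Nat.iter n rcesaro f) x.
Proof.
intros Hf; induction n as [| n IH]; simpl; auto.
apply rcesaro_continuous, IH.
Qed.

(** Linearity and locality at once: for [t] in [0,1] the average only sees [0,t]. With coefficients
    1 and 0 this also serves as congruence for equality on [0,1]. *)
Lemma rcesaro_comb (u v w : R -> R) (a b : R) :
  (forall x, continuous v x) -> (forall x, continuous w x) ->
  (forall t, 0 <= t <= 1 -> u t = a * v t + b * w t) ->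
  forall t, 0 <= t <= 1 -> rcesaro u t = a * rcesaro v t + b * rcesaro w t.
Proof.
intros Hv Hw Hu t Ht.
destruct (Req_dec t 0) as [-> | Ht0].
- rewrite !rcesaro_0; apply Hu; lra.
- rewrite !rcesaro_neq0 by auto.
  rewrite (RInt_ext u (fun s => a * v s + b * w s)).
  + rewrite (is_RInt_unique (V := R_CompleteNormedModule) (fun s => a * v s + b * w s) 0 t
               (a * RInt v 0 t + b * RInt w 0 t)); [ring |].
    apply (is_RInt_plus (V := R_NormedModule)); apply (is_RInt_scal (V := R_NormedModule));
      apply (RInt_correct (V := R_CompleteNormedModule)), continuous_ex_RInt; auto.
  + intros s; rewrite Rmin_left, Rmax_right by lra; intros Hs; apply Hu; lra.
Qed.

Lemma iter_rcesaro_comb (n : nat) (u v w : R -> R) (a b : R) :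
  (forall x, continuous v x) -> (forall x, continuous w x) ->
  (forall t, 0 <= t <= 1 -> u t = a * v t + b * w t) ->
  forall t, 0 <= t <= 1 -> Nat.iter n rcesaro u t
    = a * Nat.iter n rcesaro v t + b * Nat.iter n rcesaro w t.
Proof.
intros Hv Hw Hu; induction n as [| n IH]; simpl; auto.
apply rcesaro_comb; auto; apply iter_rcesaro_continuous; auto.
Qed.

Lemma iter_rcesaro_const (n : nat) (c t : R) :
  Nat.iter n rcesaro (fun _ => c) t = c.
Proof.
revert t; induction n as [| n IH]; intros t; simpl; auto.
destruct (rcesaro_mean (Nat.iter n rcesaro (fun _ => c)) t) as [s [_ ->]]; auto.
apply iter_rcesaro_continuous; intros x; apply continuous_const.
Qed.

(** * Pointwise majorants and their behaviour under iteration *)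

Lemma RInt_vanishing (u : R -> R) (a t : R) :
  (forall x, continuous u x) -> 0 <= a ->
  (forall s, 0 <= s < a -> u s = 0) -> RInt u 0 t = RInt u a t.
Proof.
intros Hu Ha H0.
rewrite <- (RInt_Chasles u 0 a t) by (apply continuous_ex_RInt, Hu).
rewrite (RInt_ext u (fun _ => 0) 0 a), RInt_const.
- change ((a - 0) * 0 + RInt u a t = RInt u a t :> R); ring.
- intros s; rewrite Rmin_left, Rmax_right by lra; intros Hs; apply H0; lra.
Qed.

(** Starting the majorant [Q] at [a] instead of 0 admits a [Q] that is singular at 0, such as a
    polynomial in the logarithm. *)
Lemma rcesaro_bound (u Q : R -> R) (a t I : R) :
  (forall x, continuous u x) -> 0 <= a < t ->
  (forall s, 0 <= s < a -> u s = 0) -> is_RInt Q a t I ->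
  (forall s, a <= s <= t -> Rabs (u s) <= Q s) -> Rabs (rcesaro u t) <= I / t.
Proof.
intros Hu Ha H0 HQ Hb.
rewrite rcesaro_neq0 by lra.
rewrite (RInt_vanishing u a) by (auto; lra).
rewrite Rabs_mult, Rabs_inv, (Rabs_pos_eq t) by lra.
unfold Rdiv; rewrite Rmult_comm.
apply Rmult_le_compat_r; [apply Rlt_le, Rinv_0_lt_compat; lra |].
apply (norm_RInt_le (V := R_NormedModule) u Q a t); auto; [lra |].
apply (RInt_correct (V := R_CompleteNormedModule)), continuous_ex_RInt, Hu.
Qed.

Lemma rcesaro_vanishing (u : R -> R) (a : R) : (forall x, continuous u x) ->
  (forall s, 0 <= s <= a -> u s = 0) -> forall s, 0 <= s <= a -> rcesaro u s = 0.
Proof.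
intros Hu H0 s Hs.
destruct (rcesaro_mean u s Hu) as [c [Hc ->]].
rewrite Rmin_left, Rmax_right in Hc by lra; apply H0; lra.
Qed.

Lemma iter_rcesaro_vanishing (n : nat) (u : R -> R) (a : R) :
  (forall x, continuous u x) -> (forall s, 0 <= s <= a -> u s = 0) ->
  forall s, 0 <= s <= a -> Nat.iter n rcesaro u s = 0.
Proof.
intros Hu H0; induction n as [| n IH]; simpl; auto.
apply rcesaro_vanishing; auto; apply iter_rcesaro_continuous, Hu.
Qed.

(** Averaging over [0,t] fixes constants and halves the function [t], so only the slope decays. *)
Lemma iter_rcesaro_affine_bound (n : nat) (u : R -> R) (e K : R) :
  (forall x, continuous u x) ->
  (forall t, 0 <= t <= 1 -> Rabs (u t) <= e + K * t) ->
  forall t, 0 <= t <= 1 -> Rabs (Nat.iter n rcesaro u t) <= e + K * (/ 2) ^ n * t.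
Proof.
intros Hu Hb; induction n as [| n IH]; intros t Ht; simpl Nat.iter.
- specialize (Hb t Ht); simpl; lra.
- destruct (Req_dec t 0) as [-> | Ht0].
  + rewrite rcesaro_0; specialize (IH 0 Ht); rewrite Rmult_0_r in *; exact IH.
  + set (k := K * (/ 2) ^ n) in *.
    (* The new bound is written as the increment of a primitive divided by [t], the form that
       [rcesaro_bound] and [is_RInt_derive] expect. *)
    replace (e + K * (/ 2) ^ S n * t)
      with ((e * t + k * t ^ 2 / 2 - (e * 0 + k * 0 ^ 2 / 2)) / t)
      by (unfold k; simpl; field; auto).
    apply (rcesaro_bound _ (fun s => e + k * s) 0).
    * apply iter_rcesaro_continuous, Hu.
    * lra.
    * intros s Hs; lra.
    * apply (is_RInt_derive (V := R_CompleteNormedModule) (fun s => e * s + k * s ^ 2 / 2)).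
      -- intros s _; auto_derive; [auto | field].
      -- intros s _; apply (ex_derive_continuous (fun s => e + k * s)).
         auto_derive; auto.
    * intros s Hs; apply IH; lra.
Qed.

(** With [q] the claimed bound, [s * q s] is a primitive of the given majorant: the derivative of
    the logarithm completes the square from [m - 1] to [m] and absorbs the extra [al]. The boundary
    term at [d] enters with a negative sign and is dropped. *)
Lemma rcesaro_quadratic_bound (u : R -> R) (d al m be : R) :
  (forall x, continuous u x) -> 0 < d -> (forall s, 0 <= s <= d -> u s = 0) ->
  0 <= al -> 0 <= be ->
  (forall s, 0 < s <= 1 -> Rabs (u s) <= al * (- ln s - m) ^ 2 + be) ->
  forall t, 0 < t <= 1 ->
  Rabs (rcesaro u t) <= al * (- ln t - (m - 1)) ^ 2 + (be + al).
Proof.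
intros Hu Hd H0 Hal Hbe Hb t Ht.
set (q := fun s => al * (- ln s - (m - 1)) ^ 2 + (be + al)).
assert (Hq : forall s, 0 <= q s)
  by (intros s; unfold q; assert (P := pow2_ge_0 (- ln s - (m - 1))); nra).
change (Rabs (rcesaro u t) <= q t).
destruct (Rle_dec t d) as [Htd | Htd].
- rewrite (rcesaro_vanishing u d), Rabs_R0 by (auto; lra); apply Hq.
- apply Rle_trans with ((t * q t - d * q d) / t).
  + apply (rcesaro_bound u (fun s => al * (- ln s - m) ^ 2 + be) d); auto;
      [lra | intros; apply H0; lra | |].
    * apply (is_RInt_derive (V := R_CompleteNormedModule) (fun s => s * q s)).
      -- intros s; rewrite Rmin_left, Rmax_right by lra; intros Hs.
         unfold q; auto_derive; [lra | field; lra].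
      -- intros s; rewrite Rmin_left, Rmax_right by lra; intros Hs.
         apply (ex_derive_continuous (fun s => al * (- ln s - m) ^ 2 + be)).
         auto_derive; lra.
    * intros s Hs; apply Hb; lra.
  + replace ((t * q t - d * q d) / t) with (q t - d * q d / t) by (field; lra).
    assert (0 <= d * q d / t); [| lra].
    apply Rdiv_le_0_compat; [| lra].
    apply Rmult_le_pos; [lra | apply Hq].
Qed.

Lemma iter_rcesaro_quadratic_bound (n : nat) (u : R -> R) (d al m be : R) :
  (forall x, continuous u x) -> 0 < d -> (forall s, 0 <= s <= d -> u s = 0) ->
  0 <= al -> 0 <= be ->
  (forall s, 0 < s <= 1 -> Rabs (u s) <= al * (- ln s - m) ^ 2 + be) ->
  forall t, 0 < t <= 1 -> Rabs (Nat.iter n rcesaro u t)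
    <= al * (- ln t - (m - INR n)) ^ 2 + (be + INR n * al).
Proof.
intros Hu Hd H0 Hal Hbe Hb; induction n as [| n IH]; intros t Ht.
- simpl INR; rewrite Rminus_0_r, Rmult_0_l, Rplus_0_r; apply Hb, Ht.
- rewrite S_INR; simpl Nat.iter.
  replace (m - (INR n + 1)) with (m - INR n - 1) by ring.
  replace (be + (INR n + 1) * al) with (be + INR n * al + al) by ring.
  apply (rcesaro_quadratic_bound _ d); auto.
  + apply iter_rcesaro_continuous, Hu.
  + apply iter_rcesaro_vanishing; auto.
  + assert (P := Rmult_le_pos _ _ (pos_INR n) Hal); lra.
Qed.

(** * Commutation with multiplication by the logarithm *)

Definition logmul (d : R) (g : R -> R) (t : R) : R := - ln (Rmax d t) * g t.

Lemma continuous_Rmax (d x : R) : continuous (Rmax d) x.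
Proof.
apply (filterlim_locally (U := R_UniformSpace)); intros eps.
exists eps; intros y Hy.
change (Rabs (y - x) < eps) in Hy; change (Rabs (Rmax d y - Rmax d x) < eps).
revert Hy; unfold Rmax, Rabs.
destruct (Rle_dec d x); destruct (Rle_dec d y);
  repeat destruct (Rcase_abs _); lra.
Qed.

(** The cut-off at [d] keeps the logarithm away from its singularity. When [g] vanishes on [0,d],
    the cut-off does not change the product on the half-line [t > 0]. *)
Lemma logmul_continuous (d : R) (g : R -> R) : 0 < d ->
  (forall x, continuous g x) -> forall x, continuous (logmul d g) x.
Proof.
intros Hd Hg x.
apply (continuous_mult (fun t => - ln (Rmax d t)) g); auto.
apply (continuous_comp (Rmax d) (fun y => - ln y)).
- apply continuous_Rmax.
- apply (ex_derive_continuous (fun y => - ln y)).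
  assert (P := Rmax_l d x); auto_derive; lra.
Qed.

Lemma logmul_vanishing (d : R) (g : R -> R) :
  (forall s, 0 <= s <= d -> g s = 0) -> forall s, 0 <= s <= d -> logmul d g s = 0.
Proof. intros Hg s Hs; unfold logmul; rewrite Hg by auto; ring. Qed.

(** On [d,t] the function [- ln s * RInt g 0 s] has derivative [logmul d g s - rcesaro g s].
    Integrating and dividing by [t] gives the commutator identity; for [t <= d] every term is 0. *)
Lemma rcesaro_logmul (d : R) (g : R -> R) : 0 < d -> (forall x, continuous g x) ->
  (forall s, 0 <= s <= d -> g s = 0) ->
  forall t, 0 <= t ->
  rcesaro (logmul d g) t = logmul d (rcesaro g) t + rcesaro (rcesaro g) t.
Proof.
intros Hd Hg H0 t Ht.
assert (Hl := logmul_continuous d g Hd Hg).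
assert (Hl0 := logmul_vanishing d g H0).
assert (Hc := rcesaro_continuous g Hg).
assert (Hc0 := rcesaro_vanishing g d Hg H0).
destruct (Rle_dec t d) as [Htd | Htd].
- rewrite (logmul_vanishing d (rcesaro g)) by (auto; lra).
  rewrite (rcesaro_vanishing (rcesaro g) d), (rcesaro_vanishing (logmul d g) d)
    by (auto; lra); ring.
- assert (E : RInt (fun s => logmul d g s - rcesaro g s) d t = - ln t * RInt g 0 t).
  { apply (is_RInt_unique (V := R_CompleteNormedModule)).
    (* The boundary term at [d] is 0 because [g] vanishes on [0,d]. *)
    replace (- ln t * RInt g 0 t)
      with (minus (- ln t * RInt g 0 t) (- ln d * RInt g 0 d)).
    - apply (is_RInt_derive (V := R_CompleteNormedModule) (fun s => - ln s * RInt g 0 s)).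
      + intros s; rewrite Rmin_left, Rmax_right by lra; intros Hs.
        unfold logmul; rewrite Rmax_right, rcesaro_neq0 by lra.
        replace (- ln s * g s - / s * RInt g 0 s)
          with (- / s * RInt g 0 s + - ln s * g s) by ring.
        apply (is_derive_mult (fun s => - ln s) (RInt g 0)).
        * auto_derive; lra.
        * apply is_derive_RInt_continuous, Hg.
        * apply Rmult_comm.
      + intros s _; apply (continuous_minus (V := R_NormedModule)); auto.
    - rewrite (RInt_vanishing g d d), RInt_point by (auto; intros; try apply H0; lra).
      change (- ln t * RInt g 0 t - - ln d * 0 = - ln t * RInt g 0 t); ring. }
  assert (E2 : RInt (fun s => logmul d g s - rcesaro g s) d t
               = RInt (logmul d g) d t - RInt (rcesaro g) d t).
  { apply (RInt_minus (V := R_CompleteNormedModule)); apply continuous_ex_RInt; auto. }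
  unfold logmul at 2; rewrite Rmax_right by lra.
  rewrite !(rcesaro_neq0 _ t) by lra.
  rewrite (RInt_vanishing (logmul d g) d), (RInt_vanishing (rcesaro g) d)
    by (auto; intros; try apply Hl0; try apply Hc0; lra).
  rewrite E2 in E.
  replace (RInt (logmul d g) d t)
    with (- ln t * RInt g 0 t + RInt (rcesaro g) d t) by lra; ring.
Qed.

(** Each further averaging moves past the logarithm at the cost of one more copy of the next
    iterate, so the copies add up to [n]. *)
Lemma iter_rcesaro_logmul (n : nat) (d : R) (g : R -> R) :
  0 < d -> (forall x, continuous g x) -> (forall s, 0 <= s <= d -> g s = 0) ->
  forall t, 0 <= t <= 1 -> Nat.iter n rcesaro (logmul d g) t
    = logmul d (Nat.iter n rcesaro g) t + INR n * Nat.iter (S n) rcesaro g t.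
Proof.
intros Hd Hg H0; induction n as [| n IH]; intros t Ht.
- simpl; ring.
- assert (Hc := iter_rcesaro_continuous n g Hg).
  change (Nat.iter (S n) rcesaro (logmul d g))
    with (rcesaro (Nat.iter n rcesaro (logmul d g))).
  rewrite (rcesaro_comb _ (logmul d (Nat.iter n rcesaro g))
             (Nat.iter (S n) rcesaro g) 1 (INR n)); auto.
  + rewrite rcesaro_logmul; auto.
    * rewrite S_INR; simpl; ring.
    * apply iter_rcesaro_vanishing; auto.
    * lra.
  + apply logmul_continuous; auto.
  + apply iter_rcesaro_continuous, Hg.
  + intros s Hs; rewrite IH by auto; ring.
Qed.

Lemma iter_rcesaro_diff_bound (n : nat) (d M : R) (g : R -> R) :
  (0 < n)%nat -> 0 < d -> (forall x, continuous g x) ->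
  (forall s, 0 <= s <= d -> g s = 0) ->
  (forall s, 0 <= s <= 1 -> Rabs (g s) <= M) ->
  forall t, 0 <= t <= 1 ->
  Rabs (Nat.iter n rcesaro g t - Nat.iter (S n) rcesaro g t) <= M / sqrt (INR n).
Proof.
intros Hn Hd Hg H0 HM t Ht.
assert (HN : 0 < INR n) by (apply lt_0_INR; auto).
assert (Hr : 0 < sqrt (INR n)) by (apply sqrt_lt_R0; auto).
assert (Hrr : sqrt (INR n) * sqrt (INR n) = INR n) by (apply sqrt_sqrt; lra).
assert (HM0 : 0 <= M) by (apply Rle_trans with (2 := HM 0 ltac:(lra)), Rabs_pos).
destruct (Rle_dec t d) as [Htd | Htd].
- rewrite !(iter_rcesaro_vanishing _ g d), Rminus_0_r, Rabs_R0 by (auto; lra).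
  apply Rdiv_le_0_compat; auto.
- set (r := sqrt (INR n)) in *; set (N := INR n) in *; set (c := - ln t).
  (* The evaluation point [t] is frozen in the constant [c]; the iterate of [w] is used at this
     single point only. *)
  set (w := fun s => (1 + c / N) * g s + - / N * logmul d g s).
  assert (Hw : forall x, continuous w x).
  { intros x; apply (continuous_plus (V := R_NormedModule));
      apply (continuous_scal_r (V := R_NormedModule)); auto.
    apply logmul_continuous; auto. }
  assert (E : Nat.iter n rcesaro w t
              = Nat.iter n rcesaro g t - Nat.iter (S n) rcesaro g t).
  { rewrite (iter_rcesaro_comb n w g (logmul d g) (1 + c / N) (- / N)); auto.
    - rewrite iter_rcesaro_logmul by auto.
      unfold logmul; rewrite Rmax_right by lra.
      fold N c; field; lra.
    - apply logmul_continuous; auto. }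
  rewrite <- E.
  (* The quadratic majorant starts centred at [c + N]. After [n] steps its centre is [c], so the
     square is 0 at [t], and the constants add up to [M / (2 * r) + M / (2 * r)]. *)
  replace (M / r) with (M / (2 * N * r) * (- ln t - (c + N - N)) ^ 2
                        + (M / (2 * r) + N * (M / (2 * N * r))))
    by (unfold c; field; lra).
  apply (iter_rcesaro_quadratic_bound n w d); auto; try lra.
  + intros s Hs; unfold w, logmul; rewrite H0 by auto; ring.
  + apply Rdiv_le_0_compat; nra.
  + apply Rdiv_le_0_compat; nra.
  + intros s Hs.
    (* Up to [d] the cut-off logarithm differs from [ln s], but there [w] is 0 and the majorant is
       nonnegative. *)
    destruct (Rle_dec s d) as [Hsd | Hsd].
    * unfold w, logmul; rewrite H0 by lra.
      rewrite !Rmult_0_r, Rplus_0_r, Rabs_R0.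
      apply Rplus_le_le_0_compat.
      -- apply Rmult_le_pos; [apply Rdiv_le_0_compat; nra | apply pow2_ge_0].
      -- apply Rdiv_le_0_compat; nra.
    * unfold w, logmul; rewrite Rmax_right by lra.
      set (y := - ln s - (c + N)).
      replace ((1 + c / N) * g s + - / N * (- ln s * g s)) with (- (y / N * g s))
        by (unfold y; field; lra).
      rewrite Rabs_Ropp, Rabs_mult.
      apply Rle_trans with (Rabs (y / N) * M).
      { apply Rmult_le_compat_l; [apply Rabs_pos | apply HM; lra]. }
      replace (M / (2 * N * r) * y ^ 2 + M / (2 * r))
        with ((y ^ 2 + r * r) / (2 * N * r) * M) by (rewrite Hrr; field; lra).
      apply Rmult_le_compat_r; auto.
      unfold Rdiv; rewrite Rabs_mult, Rabs_inv, (Rabs_pos_eq N) by lra.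
      (* AM-GM: [2 r |y| <= y^2 + r^2] *)
      replace (Rabs y * / N) with (2 * r * Rabs y * / (2 * N * r)) by (field; lra).
      apply Rmult_le_compat_r; [apply Rlt_le, Rinv_0_lt_compat; nra |].
      rewrite <- pow2_abs; assert (P := pow2_ge_0 (Rabs y - r)); nra.
Qed.

(** * Approximation by coboundaries and the resulting rate *)

Definition truncated_primitive (h : R -> R) (d t : R) : R :=
  RInt (fun s => h s / Rmax d s) d (Rmax d t).

Lemma truncated_quotient_continuous (h : R -> R) (d : R) : 0 < d ->
  (forall x, continuous h x) -> forall x, continuous (fun s => h s / Rmax d s) x.
Proof.
intros Hd Hh x; apply (continuous_mult h (fun s => / Rmax d s)); auto.
apply (continuous_comp (Rmax d) Rinv); [apply continuous_Rmax |].
apply continuous_Rinv; assert (P := Rmax_l d x); lra.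
Qed.

Lemma truncated_primitive_continuous (h : R -> R) (d : R) : 0 < d ->
  (forall x, continuous h x) -> forall x, continuous (truncated_primitive h d) x.
Proof.
intros Hd Hh x.
apply (continuous_comp (Rmax d) (RInt (fun s => h s / Rmax d s) d));
  [apply continuous_Rmax |].
apply (ex_derive_continuous (RInt (fun s => h s / Rmax d s) d)).
eexists; apply is_derive_RInt_continuous, truncated_quotient_continuous; auto.
Qed.

Lemma truncated_primitive_vanishing (h : R -> R) (d s : R) :
  s <= d -> truncated_primitive h d s = 0.
Proof.
intros Hs; unfold truncated_primitive; rewrite Rmax_left by lra.
apply (RInt_point (V := R_CompleteNormedModule)).
Qed.

(** For [t > d], the derivative of [s * H s] on [d,t] is [H s + h s], so [H - rcesaro H] at [t] is
    [/ t * RInt h d t]. What remains of [rcesaro h t] is [/ t * RInt h 0 d], at most [d * e / t].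
    For [t <= d] the terms in [H] are 0 and the average of [h] is one of its values on [0,d]. *)
Lemma truncated_primitive_cocycle_bound (h : R -> R) (d e : R) :
  0 < d -> (forall x, continuous h x) ->
  (forall s, 0 <= s <= d -> Rabs (h s) <= e) ->
  let H := truncated_primitive h d in
  forall t, 0 <= t ->
  Rabs (rcesaro h t - (H t - rcesaro H t)) <= e.
Proof.
intros Hd Hh He H t Ht.
assert (He0 : 0 <= e) by (apply Rle_trans with (2 := He 0 ltac:(lra)), Rabs_pos).
assert (Hk := truncated_quotient_continuous h d Hd Hh).
set (H1 := RInt (fun s => h s / Rmax d s) d).
assert (DH1 : forall x, is_derive H1 x (h x / Rmax d x))
  by (intros x; apply (is_derive_RInt_continuous (fun s => h s / Rmax d s)), Hk).
assert (CH1 : forall x, continuous H1 x)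
  by (intros x; apply (ex_derive_continuous H1); eexists; apply DH1).
assert (HH : forall x, continuous H x)
  by (apply truncated_primitive_continuous; auto).
assert (H0 : forall s, 0 <= s <= d -> H s = 0)
  by (intros s Hs; apply truncated_primitive_vanishing; lra).
destruct (Rle_dec t d) as [Htd | Htd].
- rewrite (rcesaro_vanishing H d), H0, !Rminus_0_r by (auto; lra).
  destruct (rcesaro_mean h t Hh) as [c [Hc ->]].
  rewrite Rmin_left, Rmax_right in Hc by lra; apply He; lra.
- assert (E : RInt (fun s => H s + h s) d t = t * H t).
  { apply (is_RInt_unique (V := R_CompleteNormedModule)).
    apply (is_RInt_ext (V := R_NormedModule) (fun s => 1 * H1 s + s * (h s / Rmax d s))).
    - intros s; rewrite Rmin_left, Rmax_right by lra; intros Hs.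
      change (1 * H1 s + s * (h s / Rmax d s) = H1 (Rmax d s) + h s).
      rewrite Rmax_right by lra; field; lra.
    - replace (t * H t) with (minus (t * H1 t) (d * H1 d)).
      + apply (is_RInt_derive (V := R_CompleteNormedModule) (fun s => s * H1 s)).
        * intros s _; apply (is_derive_mult (fun s => s) H1); auto.
          -- apply (is_derive_id (K := R_AbsRing)).
          -- apply Rmult_comm.
        * intros s _; apply (continuous_plus (V := R_NormedModule)).
          -- apply (continuous_scal_r (V := R_NormedModule)), CH1.
          -- apply (continuous_mult (fun s => s) (fun s => h s / Rmax d s));
             [apply continuous_id | apply Hk].
      + unfold H, truncated_primitive; rewrite Rmax_right by lra; fold (H1 t).
        unfold H1 at 2; rewrite RInt_point.
        change (t * H1 t - d * 0 = t * H1 t); ring. }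
  assert (E2 : RInt (fun s => H s + h s) d t = RInt H d t + RInt h d t).
  { apply (RInt_plus (V := R_CompleteNormedModule)); apply continuous_ex_RInt; auto. }
  assert (E3 : RInt h 0 d + RInt h d t = RInt h 0 t).
  { apply (RInt_Chasles (V := R_CompleteNormedModule)); apply continuous_ex_RInt; auto. }
  rewrite !(rcesaro_neq0 _ t) by lra.
  rewrite (RInt_vanishing H d) by (auto; intros; try apply H0; lra).
  replace (/ t * RInt h 0 t - (H t - / t * RInt H d t)) with (/ t * RInt h 0 d).
  + assert (B : Rabs (RInt h 0 d) <= (d - 0) * e).
    { apply abs_RInt_le_const; [lra | apply continuous_ex_RInt, Hh |].
      intros s Hs; apply He, Hs. }
    rewrite Rabs_mult, Rabs_inv, (Rabs_pos_eq t) by lra.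
    replace e with (/ t * (t * e)) by (field; lra).
    apply Rmult_le_compat_l; [apply Rlt_le, Rinv_0_lt_compat; lra | nra].
  + replace (H t) with (/ t * (t * H t)) by (field; lra).
    rewrite <- E, E2, <- E3; ring.
Qed.

(** One application of the operator is spent on replacing [rcesaro h] by a coboundary plus a small
    remainder; the other [n] act on that sum. Hence the iterate [S n] is paired with
    [sqrt (INR n)]. *)
Lemma iter_rcesaro_rate (n : nat) (h : R -> R) (M : R) :
  (0 < n)%nat -> (forall x, continuous h x) -> h 0 = 0 ->
  (forall d t, 0 < d <= t -> t <= 1 -> Rabs (RInt (fun s => h s / s) d t) <= M) ->
  forall t, 0 <= t <= 1 -> Rabs (Nat.iter (S n) rcesaro h t) <= M / sqrt (INR n).
Proof.
intros Hn Hh h0 HM t Ht.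
(* The cut-off [d] and the primitive [H] depend on [e], but the bound [M] on [H] does not, so the
   error [e] can be sent to 0. *)
apply le_epsilon; intros e He.
destruct (proj1 (filterlim_locally (U := R_UniformSpace) (F := locally 0) _ _)
            (Hh 0) (mkposreal e He)) as [d1 Hd1].
set (d := Rmin (d1 / 2) 1).
assert (Hd : 0 < d <= 1 /\ d < d1)
  by (destruct d1 as [d1 P1]; unfold d, Rmin; simpl; destruct (Rle_dec _ _); lra).
assert (Hsm : forall s, 0 <= s <= d -> Rabs (h s) <= e).
{ intros s Hs; apply Rlt_le.
  assert (P : ball (M := R_UniformSpace) (h 0) e (h s)).
  { apply (Hd1 s); change (Rabs (s - 0) < d1); rewrite Rabs_pos_eq; lra. }
  change (Rabs (h s - h 0) < e) in P; rewrite h0, Rminus_0_r in P; exact P. }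
set (H := truncated_primitive h d).
assert (HH : forall x, continuous H x)
  by (apply truncated_primitive_continuous; auto; lra).
set (r := fun t => rcesaro h t - (H t - rcesaro H t)).
assert (Hr : forall s, 0 <= s <= 1 -> Rabs (r s) <= e).
{ intros s Hs; apply (truncated_primitive_cocycle_bound h d e); auto; lra. }
assert (Ch := rcesaro_continuous h Hh).
assert (CH := rcesaro_continuous H HH).
set (v := fun t => H t - rcesaro H t).
assert (Cv : forall x, continuous v x)
  by (intros x; apply (continuous_minus (V := R_NormedModule)); auto).
assert (Cr : forall x, continuous r x)
  by (intros x; apply (continuous_minus (V := R_NormedModule)); auto).
rewrite Nat.iter_succ_r.
rewrite (iter_rcesaro_comb n (rcesaro h) v r 1 1) by (auto; intros; unfold r, v; ring).
rewrite (iter_rcesaro_comb n v H (rcesaro H) 1 (-1)) by (auto; intros; unfold v; ring).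
rewrite <- Nat.iter_succ_r, !Rmult_1_l.
eapply Rle_trans; [apply Rabs_triang | apply Rplus_le_compat].
- replace (Nat.iter n rcesaro H t + -1 * Nat.iter (S n) rcesaro H t)
    with (Nat.iter n rcesaro H t - Nat.iter (S n) rcesaro H t) by ring.
  apply (iter_rcesaro_diff_bound n d); auto; [lra | |].
  + intros s Hs; apply truncated_primitive_vanishing; lra.
  + intros s Hs; unfold H, truncated_primitive.
    rewrite (RInt_ext _ (fun s => h s / s)).
    * apply HM; unfold Rmax; destruct (Rle_dec d s); lra.
    * assert (P := Rmax_l d s); intros x; rewrite Rmin_left by lra; intros Hx.
      rewrite (Rmax_right d x) by lra; reflexivity.
(* With slope 0 the affine bound says that averaging does not enlarge a uniform bound on [0,1]. *)
- assert (P := iter_rcesaro_affine_bound n r e 0 Cr).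
  replace e with (e + 0 * (/ 2) ^ n * t) by ring.
  apply P; auto; intros s Hs; rewrite Rmult_0_l, Rplus_0_r; auto.
Qed.

Lemma improper_integral_bound (h : R -> R) (l : R) : (forall x, continuous h x) ->
  filterlim (fun eps => RInt (fun s => h s / s) eps 1) (at_right 0) (locally l) ->
  exists M, forall d t, 0 < d <= t -> t <= 1 ->
    Rabs (RInt (fun s => h s / s) d t) <= M.
Proof.
intros Hh Hl.
destruct (proj1 (filterlim_locally (U := R_UniformSpace) (F := at_right 0) _ _)
            Hl (mkposreal 1 Rlt_0_1)) as [eta Heta].
assert (Ck : forall x, 0 < x -> continuous (fun s => h s / s) x).
{ intros x Hx; apply (continuous_mult h Rinv); auto; apply continuous_Rinv; lra. }
assert (Ek : forall a b, 0 < a -> 0 < b -> ex_RInt (fun s => h s / s) a b).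
{ intros a b Ha Hb; apply (ex_RInt_continuous (V := R_CompleteNormedModule)).
  intros x Hx; apply Ck; revert Hx; unfold Rmin; destruct (Rle_dec a b); lra. }
(* For lower limits below [a] the convergence bounds the integral up to 1; on [a,1] the integrand is
   bounded by compactness. *)
set (a := Rmin (eta / 2) 1).
assert (Ha : 0 < a <= 1 /\ a < eta)
  by (destruct eta as [x Px]; unfold a, Rmin; simpl; destruct (Rle_dec _ _); lra).
destruct (continuity_ab_maj (fun s => Rabs (h s / s)) a 1) as [m [Hm _]]; [lra | |].
{ intros c Hc; apply continuity_pt_filterlim.
  apply (continuous_comp (fun s => h s / s) Rabs); [apply Ck; lra |].
  apply continuous_Rabs. }
set (B := Rabs (h m / m)) in *.
assert (HB : 0 <= B) by apply Rabs_pos.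
assert (K : forall d, 0 < d <= 1 ->
            Rabs (RInt (fun s => h s / s) d 1) <= B + (Rabs l + 1)).
{ intros d Hd; assert (P := Rabs_pos l).
  destruct (Rlt_dec d a) as [Hda | Hda].
  - assert (Q : ball (M := R_UniformSpace) l 1 (RInt (fun s => h s / s) d 1)).
    { apply Heta; [| lra].
      change (Rabs (d - 0) < eta); rewrite Rabs_pos_eq; lra. }
    change (Rabs (RInt (fun s => h s / s) d 1 - l) < 1) in Q.
    assert (Q2 := Rabs_triang_inv (RInt (fun s => h s / s) d 1) l); lra.
  - apply Rle_trans with ((1 - d) * B); [| nra].
    apply abs_RInt_le_const; [lra | apply Ek; lra |].
    intros s Hs; apply Hm; lra. }
(* The integral from [d] to [t] is a difference of two integrals ending at 1, whence the factor
   2. *)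
exists (2 * (B + (Rabs l + 1))); intros d t Hd Ht.
assert (E : RInt (fun s => h s / s) d t + RInt (fun s => h s / s) t 1
            = RInt (fun s => h s / s) d 1)
  by (apply (RInt_Chasles (V := R_CompleteNormedModule)); apply Ek; lra).
replace (RInt (fun s => h s / s) d t)
  with (RInt (fun s => h s / s) d 1 - RInt (fun s => h s / s) t 1) by lra.
assert (K1 := K d ltac:(lra)); assert (K2 := K t ltac:(lra)).
assert (P := Rabs_triang (RInt (fun s => h s / s) d 1) (- RInt (fun s => h s / s) t 1)).
rewrite Rabs_Ropp in P; unfold Rminus; lra.
Qed.

(** Near 0 continuity gives [e]; for [t >= d] the maximum [B] is at most [B / d * t]. *)
Lemma continuous_affine_bound (h : R -> R) (e : R) :
  (forall x, continuous h x) -> h 0 = 0 -> 0 < e ->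
  exists K, forall t, 0 <= t <= 1 -> Rabs (h t) <= e + K * t.
Proof.
intros Hh h0 He.
destruct (proj1 (filterlim_locally (U := R_UniformSpace) (F := locally 0) _ _)
            (Hh 0) (mkposreal e He)) as [d Hd].
destruct (continuity_ab_maj (fun s => Rabs (h s)) 0 1) as [m [Hm _]]; [lra | |].
{ intros c Hc; apply continuity_pt_filterlim.
  apply (continuous_comp h Rabs); [apply Hh | apply continuous_Rabs]. }
set (B := Rabs (h m)) in *.
assert (HB : 0 <= B) by apply Rabs_pos.
assert (Pd := cond_pos d).
exists (B / d); intros t Ht.
destruct (Rlt_dec t d) as [Htd | Htd].
- assert (P : ball (M := R_UniformSpace) (h 0) e (h t)).
  { apply (Hd t); change (Rabs (t - 0) < d); rewrite Rabs_pos_eq; lra. }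
  change (Rabs (h t - h 0) < e) in P; rewrite h0, Rminus_0_r in P.
  assert (0 <= B / d * t); [| lra].
  apply Rmult_le_pos; [apply Rdiv_le_0_compat |]; lra.
- apply Rle_trans with B; [apply Hm, Ht |].
  replace (B / d * t) with (B * (t / d)) by (field; lra).
  assert (1 <= t / d); [| nra].
  apply (Rmult_le_reg_r d); auto; unfold Rdiv.
  rewrite Rmult_assoc, Rinv_l by lra; lra.
Qed.

(** * Reduction to real and imaginary parts, indexed by a boolean *)

Definition part (b : bool) (z : C) : R := if b then fst z else snd z.

Lemma part_continuous (b : bool) (z : C) :
  continuous (T := C_UniformSpace) (U := R_UniformSpace) (part b) z.
Proof. destruct b; [apply continuous_fst | apply continuous_snd]. Qed.

Lemma part_RInt (b : bool) (f : R -> C) (x y : R) :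
  ex_RInt (V := C_R_NormedModule) f x y ->
  part b (RInt (V := C_R_CompleteNormedModule) f x y)
  = RInt (fun s => part b (f s)) x y.
Proof.
intros Hf; symmetry; apply (is_RInt_unique (V := R_CompleteNormedModule)).
apply (RInt_correct (V := C_R_CompleteNormedModule)) in Hf.
destruct b.
- apply (is_RInt_fct_extend_fst (U := R_NormedModule) (V := R_NormedModule) f), Hf.
- apply (is_RInt_fct_extend_snd (U := R_NormedModule) (V := R_NormedModule) f), Hf.
Qed.

(** Clamping extends the part of [f] by constants outside [0,1], turning relative continuity on
    [0,1] into continuity on the line. *)
Definition real_fun (b : bool) (f : C01) (t : R) : R := part b (f (clamp t)).

Lemma real_fun_continuous (b : bool) (f : C01) (x : R) : continuous (real_fun b f) x.
Proof.
apply (continuous_comp (V := C_UniformSpace) (fun t => f (clamp t)) (part b)).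
- apply C01_clamp_continuous.
- apply part_continuous.
Qed.

Lemma part_real_scal (b : bool) (r : R) (z : C) : part b (RtoC r * z)%C = r * part b z.
Proof. destruct b; simpl; ring. Qed.

Lemma part_minus (b : bool) (y z : C) : part b (y - z)%C = part b y - part b z.
Proof. destruct b; reflexivity. Qed.

Lemma part_cesaro (b : bool) (f : C01) (t : R) : unit_interval t ->
  part b (cesaro f t) = rcesaro (real_fun b f) t.
Proof.
intros Ht; change (cesaro f t) with (cesaro_fun f t).
unfold cesaro_fun, rcesaro; destruct (Req_EM_T t 0) as [-> | Ht0].
- unfold real_fun; rewrite clamp_id; auto.
- rewrite <- RtoC_inv, part_real_scal, C01_RInt_clamp, part_RInt
    by auto using C01_clamp_ex_RInt.
  reflexivity.
Qed.

Lemma part_iter_cesaro (b : bool) (n : nat) (f : C01) (t : R) : unit_interval t ->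
  part b (Nat.iter n cesaro f t) = Nat.iter n rcesaro (real_fun b f) t.
Proof.
revert t; induction n as [| n IH]; intros t Ht.
- simpl; unfold real_fun; rewrite clamp_id; auto.
- change (Nat.iter (S n) cesaro f) with (cesaro (Nat.iter n cesaro f)).
  rewrite part_cesaro by auto; simpl.
  assert (C1 : forall x, continuous (Nat.iter n rcesaro (real_fun b f)) x)
    by apply iter_rcesaro_continuous, real_fun_continuous.
  (* The induction hypothesis is an equality on [0,1] only, hence the congruence form of
     [rcesaro_comb]. *)
  rewrite (rcesaro_comb _ (Nat.iter n rcesaro (real_fun b f))
             (Nat.iter n rcesaro (real_fun b f)) 1 0); auto; [ring |].
  intros s Hs; unfold real_fun at 1; rewrite clamp_id, IH by auto; ring.
Qed.

Definition centered (b : bool) (f : C01) (t : R) : R := real_fun b f t - part b (f 0).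

Lemma centered_continuous (b : bool) (f : C01) (x : R) : continuous (centered b f) x.
Proof.
apply (continuous_minus (V := R_NormedModule)); [apply real_fun_continuous |].
apply continuous_const.
Qed.

Lemma centered_0 (b : bool) (f : C01) : centered b f 0 = 0.
Proof.
unfold centered, real_fun; rewrite clamp_id; [ring | unfold unit_interval; lra].
Qed.

(** Constants are fixed by the iterates, so subtracting [f 0] before or after iterating is the
    same. *)
Lemma part_iter_cesaro_error (b : bool) (n : nat) (f : C01) (t : R) : unit_interval t ->
  part b (C01_minus (Nat.iter n cesaro f) (eval0 f) t) = Nat.iter n rcesaro (centered b f) t.
Proof.
intros Ht; simpl; rewrite part_minus, part_iter_cesaro by auto.
rewrite (iter_rcesaro_comb n (centered b f) (real_fun b f) (fun _ => part b (f 0)) 1 (-1)).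
- rewrite iter_rcesaro_const; ring.
- apply real_fun_continuous.
- intros x; apply continuous_const.
- intros s _; unfold centered; ring.
- exact Ht.
Qed.

Lemma Cmod_le_parts (z : C) (M : R) : (forall b, Rabs (part b z) <= M) -> Cmod z <= 2 * M.
Proof.
intros HM; assert (H1 := HM true); assert (H2 := HM false); simpl in *.
apply Rle_trans with (Cmod (RtoC (fst z)) + Cmod (Ci * RtoC (snd z))).
- eapply Rle_trans; [| apply Cmod_triangle].
  right; f_equal; destruct z as [x y]; unfold RtoC, Ci, Cplus, Cmult; simpl.
  f_equal; ring.
- rewrite Cmod_mult, !Cmod_R.
  replace (Cmod Ci) with 1; [lra |].
  unfold Cmod, Ci; simpl; rewrite <- sqrt_1 at 1; f_equal; ring.
Qed.

Lemma supnorm_error_bound (n : nat) (f : C01) (M : R) :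
  (forall b t, 0 <= t <= 1 -> Rabs (Nat.iter n rcesaro (centered b f) t) <= M) ->
  Rabs (supnorm (C01_minus (Nat.iter n cesaro f) (eval0 f))) <= 2 * M.
Proof.
intros HM.
set (u := C01_minus _ _).
destruct (supnorm_is_lub u) as [U L].
rewrite Rabs_pos_eq.
- apply L; intros r [t [Ht ->]]; apply Cmod_le_parts; intros b.
  unfold u; rewrite part_iter_cesaro_error by auto; apply HM, Ht.
- apply Rle_trans with (Cmod (u 0)); [apply Cmod_ge_0 |].
  apply U; exists 0; split; [unfold unit_interval; lra | reflexivity].
Qed.

(** Taking parts is continuous, so it passes to the limit. Exchanging it with [RInt] requires
    integrability on [x,1] for [0 < x < 1], obtained from the clamped integrand, which is continuous
    there and agrees with the given one. *)
Lemma improper_integral_part (b : bool) (f : C01) : improper_integral_exists f ->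
  exists l, filterlim (fun eps => RInt (fun s => centered b f s / s) eps 1)
              (at_right 0) (locally l).
Proof.
intros [l Hl]; exists (part b l).
apply (filterlim_ext_loc (fun eps => part b (RInt (V := C_R_CompleteNormedModule)
                    (fun t => (f t - f 0) / RtoC t)%C eps 1))).
- exists (mkposreal 1 Rlt_0_1); intros x Hx Hx0.
  change (Rabs (x - 0) < 1) in Hx; rewrite Rabs_pos_eq in Hx by lra.
  assert (E : forall s, Rmin x 1 < s < Rmax x 1 ->
     (RtoC (/ s) * (f (clamp s) - f 0))%C = ((f s - f 0) / RtoC s)%C).
  { intros s; rewrite Rmin_left, Rmax_right by lra; intros Hs.
    rewrite clamp_id by (unfold unit_interval; lra).
    rewrite RtoC_inv by lra; unfold Cdiv; ring. }
  rewrite part_RInt.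
  + apply (RInt_ext (V := R_CompleteNormedModule)); intros s Hs.
    rewrite <- E by auto; rewrite part_real_scal, part_minus.
    apply Rmult_comm.
  + apply (ex_RInt_ext (V := C_R_NormedModule)
             (fun s => (RtoC (/ s) * (f (clamp s) - f 0))%C)); [exact E |].
    apply (ex_RInt_ext (V := C_R_NormedModule)
      (fun s => scal (V := C_R_NormedModule) (/ s)
         (minus (G := C_R_NormedModule) (f (clamp s)) (f 0)))).
    { intros s _; apply scal_R_Cmult. }
    apply (ex_RInt_continuous (V := C_R_CompleteNormedModule)).
    intros s; rewrite Rmin_left, Rmax_right by lra; intros Hs.
    apply (continuous_scal (V := C_R_NormedModule) (fun s => / s)).
    * apply continuous_Rinv; lra.
    * apply (continuous_minus (V := C_R_NormedModule)).
      -- apply C01_clamp_continuous.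
      -- apply (continuous_const (V := C_UniformSpace)).
- apply (filterlim_comp _ _ _ _ (part b) _ (locally (T := C_UniformSpace) l)); auto.
  apply part_continuous.
Qed.

Theorem theorem4p2 :
  (forall f : C01,
     is_lim_seq (fun n => supnorm (C01_minus (Nat.iter n cesaro f) (eval0 f))) 0)
  /\
  (forall f : C01,
     improper_integral_exists f ->
     bigO (fun n => supnorm (C01_minus (Nat.iter n cesaro f) (eval0 f)))
          (fun n => Rpower (INR n) (- (1 / 2)))).
Proof.
split; intros f.
- apply is_lim_seq_spec; intros eps.
  (* Each part is bounded by [eps / 8] from the constant and [eps / 8] from the decaying slope; the
     factor 2 for combining the parts gives [eps / 2]. *)
  assert (He : 0 < eps / 8) by (destruct eps; simpl; lra).
  assert (HK : exists K, forall b t, 0 <= t <= 1 ->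
                 Rabs (centered b f t) <= eps / 8 + K * t).
  { destruct (continuous_affine_bound (centered true f) _
                (centered_continuous true f) (centered_0 true f) He) as [K1 H1].
    destruct (continuous_affine_bound (centered false f) _
                (centered_continuous false f) (centered_0 false f) He) as [K2 H2].
    exists (Rmax K1 K2); intros b t Ht.
    assert (P1 := Rmax_l K1 K2); assert (P2 := Rmax_r K1 K2).
    destruct b; [specialize (H1 t Ht) | specialize (H2 t Ht)]; nra. }
  destruct HK as [K HK].
  assert (HG : is_lim_seq (fun n => Rabs K * (/ 2) ^ n) 0).
  { replace (Finite 0) with (Rbar_mult (Rabs K) 0) by (simpl; f_equal; ring).
    apply is_lim_seq_scal_l, is_lim_seq_geom; rewrite Rabs_pos_eq; lra. }
  apply is_lim_seq_spec in HG.
  destruct (HG (mkposreal _ He)) as [N HN].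
  exists N; intros n Hn; specialize (HN n Hn); simpl in HN.
  rewrite Rminus_0_r in *.
  eapply Rle_lt_trans; [apply (supnorm_error_bound n f (eps / 8 + eps / 8)) | lra].
  intros b t Ht.
  eapply Rle_trans.
  + apply iter_rcesaro_affine_bound; [apply centered_continuous | apply HK | exact Ht].
  + assert (Hp : 0 <= (/ 2) ^ n) by (apply pow_le; lra).
    assert (P := Rle_abs K); assert (P2 := Rabs_pos K).
    rewrite Rabs_pos_eq in HN by (apply Rmult_le_pos; lra).
    assert (K * (/ 2) ^ n * t <= Rabs K * (/ 2) ^ n); [| lra].
    apply Rle_trans with (Rabs K * (/ 2) ^ n * t);
      [| assert (P3 := Rmult_le_pos _ _ P2 Hp); nra].
    apply Rmult_le_compat_r; [lra |]; apply Rmult_le_compat_r; lra.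
- intros Hf.
  assert (HM : exists M, forall b d t, 0 < d <= t -> t <= 1 ->
            Rabs (RInt (fun s => centered b f s / s) d t) <= M).
  { destruct (improper_integral_part true f Hf) as [l1 H1].
    destruct (improper_integral_part false f Hf) as [l2 H2].
    apply improper_integral_bound in H1; [| apply centered_continuous].
    apply improper_integral_bound in H2; [| apply centered_continuous].
    destruct H1 as [M1 H1]; destruct H2 as [M2 H2].
    exists (Rmax M1 M2); intros b d t Hd Ht.
    destruct b; eapply Rle_trans; eauto; [apply Rmax_l | apply Rmax_r]. }
  destruct HM as [M HM].
  (* The degenerate interval with both ends at 1 shows that [M] is nonnegative. *)
  assert (HM0 : 0 <= M)
    by (eapply Rle_trans; [apply Rabs_pos | apply (HM true 1 1); lra]).
  (* One factor 2 combines the two parts, the other pays for passing from [sqrt (INR n)] to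
     [sqrt (INR (S n))]. Starting at 2 makes the predecessor positive. *)
  exists (2 * (2 * M)), 2%nat; intros n Hn.
  destruct n as [| n]; [lia |].
  assert (Hn1 : 0 < INR n) by (apply lt_0_INR; lia).
  eapply Rle_trans; [apply (supnorm_error_bound (S n) f (M / sqrt (INR n))) |].
  + intros b t Ht; apply iter_rcesaro_rate; auto.
    * lia.
    * apply centered_continuous.
    * apply centered_0.
  + assert (HS : 0 < INR (S n)) by (apply lt_0_INR; lia).
    rewrite Rpower_Ropp, Rdiv_1_l, Rpower_sqrt by auto.
    assert (Q1 := sqrt_lt_R0 _ Hn1); assert (Q2 := sqrt_lt_R0 _ HS).
    rewrite Rabs_inv, (Rabs_pos_eq (sqrt (INR (S n)))) by lra.
    (* This is [n + 1 <= 4 * n] under the root, valid for [n >= 1]. *)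
    assert (Q : sqrt (INR (S n)) <= 2 * sqrt (INR n)).
    { rewrite <- (sqrt_pow2 2) by lra; rewrite <- sqrt_mult by lra.
      apply sqrt_le_1_alt; rewrite S_INR.
      assert (1 <= INR n) by (apply (le_INR 1); lia); lra. }
    rewrite Rmult_assoc; apply Rmult_le_compat_l; [lra |].
    replace (2 * M * / sqrt (INR (S n)))
      with (M * (2 * sqrt (INR n)) / (sqrt (INR n) * sqrt (INR (S n))))
      by (field; lra).
    replace (M / sqrt (INR n))
      with (M * sqrt (INR (S n)) / (sqrt (INR n) * sqrt (INR (S n))))
      by (field; lra).
    apply Rmult_le_compat_r.
    * apply Rlt_le, Rinv_0_lt_compat; nra.
    * apply Rmult_le_compat_l; lra.
Qed.
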